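(* For the $2\times2\times2$ cube, $P_2=2$.
   Context: For a positive integer $n$, an initial state of the $n\times n\times n$ cube of lights is an array $A=(A_{ijk})_{0\le i,j,k\le n-1}$ with entries $A_{ijk}\in\{+1,-1\}$ ($+1$ for on, $-1$ for off). There are $3n$ plane switches $x_i,y_j,z_k$ ($0\le i,j,k\le n-1$): switch $x_i$ flips (changes the sign of) all lights $A_{ijk}$ with first coordinate $i$, switch $y_j$ flips all lights with second coordinate $j$, and switch $z_k$ flips all lights with third coordinate $k$. The imbalance of a state is the absolute difference between the number of lights on and the number of lights off. Writing $x_i,y_j,z_k=-1$ if the corresponding switch is thrown and $+1$ otherwise, the imbalance after throwing the switches is $\big|\sum_{i,j,k}x_iy_jz_kA_{ijk}\big|$. The number $P_n$ is defined as the minimum value such that for every initial state $A$ of the $n\times n\times n$ cube there exist $x,y,z\in\{\pm1\}^n$ with $\big|\sum_{i,j,k}x_iy_jz_kA_{ijk}\big|\le P_n$. *)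

(* Defs.v *)
From mathcomp Require Import all_boot all_order all_algebra.
Set Implicit Arguments.
Unset Strict Implicit.
Unset Printing Implicit Defensive.
Import Order.TTheory GRing.Theory Num.Theory.
Local Open Scope ring_scope.

(* The finite type {+1, -1}; [val] is the inclusion into [int]. *)
Definition sign : finType := seq_sub [:: 1%:Z; - 1%:Z].

(* [A (i, j, k)] is A_ijk: +1 if the light is on, -1 if it is off. *)
Definition cube (n : nat) : finType := {ffun 'I_n * 'I_n * 'I_n -> sign}.

(* A setting of n parallel plane switches: -1 if thrown, +1 otherwise. *)
Definition switches (n : nat) : finType := {ffun 'I_n -> sign}.

Definition imbalance_after (n : nat) (A : cube n) (x y z : switches n) : nat :=
  `|(\sum_(i < n) \sum_(j < n) \sum_(k < n)
       val (x i) * val (y j) * val (z k) * val (A (i, j, k)))%R|%N.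

Definition attainable (n m : nat) : bool :=
  [forall A : cube n, exists x : switches n, exists y : switches n,
     exists z : switches n, (imbalance_after A x y z <= m)%N].

Fact attainable_ex (n : nat) : exists m, attainable n m.
Proof.
have one : sign by exists 1; rewrite inE eqxx.
pose u : switches n := [ffun=> one].
exists (\max_(A : cube n) imbalance_after A u u u).
apply/forallP=> A; apply/existsP; exists u; apply/existsP; exists u.
by apply/existsP; exists u; apply: leq_bigmax.
Qed.

Definition P (n : nat) : nat := ex_minn (attainable_ex n).

Lemma P_min (n : nat) :
  attainable n (P n) /\ forall m, attainable n m -> (P n <= m)%N.
Proof. by rewrite /P; case: ex_minnP. Qed.

(* The imbalance is the difference between the numbers of lights on and off
   once the switches x, y, z have been thrown. *)
Lemma imbalance_afterE (n : nat) (A : cube n) (x y z : switches n) :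
  let light (p : 'I_n * 'I_n * 'I_n) :=
    val (x p.1.1) * val (y p.1.2) * val (z p.2) * val (A p) in
  imbalance_after A x y z =
    `|(#|[set p | light p == 1]|%:Z - #|[set p | light p == -1]|%:Z)%R|%N.
Proof.
move=> light; rewrite /imbalance_after; congr absz.
have light1 p : (light p == 1) || (light p == -1).
  have sP (s : sign) : (val s == 1) || (val s == -1).
    by have := valP s; rewrite !inE.
  rewrite /light.
  by case/orP: (sP (x p.1.1)) => /eqP->; case/orP: (sP (y p.1.2)) => /eqP->;
     case/orP: (sP (z p.2)) => /eqP->; case/orP: (sP (A p)) => /eqP->.
transitivity (\sum_p light p).
  under eq_bigr do rewrite pair_bigA.
  rewrite pair_bigA.
  rewrite (reindex (fun p : 'I_n * 'I_n * 'I_n => (p.1.1, (p.1.2, p.2)))) /=.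
    by apply: eq_bigr => -[[i j] k].
  by exists (fun p => (p.1, p.2.1, p.2.2)) => [[[? ?] ?]|[? [? ?]]].
have cardZ (Q : pred ('I_n * 'I_n * 'I_n)) :
    #|[set p | Q p]|%:Z = \sum_p (Q p : nat)%:Z.
  rewrite cardsE -sum1_card big_mkcond -natz natr_sum.
  by apply: eq_bigr => p _; rewrite natz unfold_in; case: (Q p).
rewrite !cardZ -sumrB; apply: eq_bigr => p _.
by case/orP: (light1 p) => /eqP->.
Qed.

(* Main.v *)
Require Import Defs.
From mathcomp Require Import all_boot all_order all_algebra.
From mathcomp Require Import zify ring.

Set Implicit Arguments.
Unset Strict Implicit.
Unset Printing Implicit Defensive.

(** Upper bound: choose all switches independently and uniformly at random.
    Distinct lights then contribute uncorrelated signs to the signed sum [S],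
    so the mean of [S ^ 2] is the number [n ^ 3] of lights, and some setting of
    the switches has [S ^ 2 <= n ^ 3] ([imbalance_sqr_le]). For [n = 2] this
    reads [S ^ 2 <= 8], hence [|S| <= 2].

    Lower bound: when [n] is even, a switch flips the even number [n ^ 2] of
    lights, so the product of all lights never changes. A sum of signs is
    determined modulo 4 by their number and their product ([sum_signs_mod4]);
    hence a cube of side 2 with exactly one light off has [S = 2] modulo 4
    whatever the switches, so [|S| >= 2]. *)

Import Order.TTheory GRing.Theory Num.Theory.

Section Cube.

Local Open Scope ring_scope.

Implicit Types (n : nat) (s : sign).

Lemma signP s : val s = 1 \/ val s = -1.
Proof. by have := valP s; rewrite !inE => /orP[] /eqP; [left|right]. Qed.

Lemma sqr_sign s : val s ^+ 2 = 1.
Proof. by case: (signP s) => ->. Qed.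

Lemma opp_sign_subproof s : - val s \in [:: 1%:Z; - 1%:Z].
Proof. by case: (signP s) => ->. Qed.

Definition opp_sign s : sign := SeqSub (opp_sign_subproof s).

Lemma opp_signK : involutive opp_sign.
Proof. by move=> s; apply: val_inj; rewrite /= opprK. Qed.

Definition plus : sign := SeqSub (mem_head 1%:Z [:: - 1%:Z]).

Definition toggle n (i : 'I_n) (x : switches n) : switches n :=
  [ffun k => if k == i then opp_sign (x k) else x k].

Lemma toggleK n (i : 'I_n) : involutive (toggle i).
Proof.
by move=> x; apply/ffunP=> k; rewrite !ffunE; case: eqP; rewrite // opp_signK.
Qed.

(** Toggling the switch [i] pairs off the settings with opposite values of
    [x i * x j]. *)
Lemma sum_switches_uncorrelated n (i j : 'I_n) : i != j ->
  \sum_(x : switches n) val (x i) * val (x j) = 0.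
Proof.
move=> neq_ij; set T := LHS; suff: T = - T by lia.
rewrite {1}/T (reindex_inj (inv_inj (toggleK i))) -sumrN.
apply: eq_bigr => x _; rewrite !ffunE eqxx eq_sym (negPf neq_ij) /=.
by rewrite mulNr.
Qed.

Lemma sum_switches_sqr n (a : 'I_n -> int) :
  \sum_(x : switches n) (\sum_i val (x i) * a i) ^+ 2
  = (\sum_i a i ^+ 2) *+ #|switches n|.
Proof.
transitivity (\sum_i \sum_j (a i * a j) *
                \sum_(x : switches n) val (x i) * val (x j)).
  under eq_bigr do rewrite expr2 big_distrlr /=.
  rewrite exchange_big; apply: eq_bigr => i _.
  rewrite exchange_big; apply: eq_bigr => j _.
  by rewrite big_distrr; apply: eq_bigr => x _ /=; ring.
rewrite -sumrMnl; apply: eq_bigr => i _.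
rewrite (bigD1 i) //= [X in _ + X]big1 ?addr0 => [|j neq_ji]; last first.
  by rewrite sum_switches_uncorrelated ?mulr0 // eq_sym.
under eq_bigr do rewrite -expr2 sqr_sign.
by rewrite sumr_const -expr2 mulr_natr.
Qed.

Definition signed_sum n (A : cube n) (x y z : switches n) : int :=
  \sum_i \sum_j \sum_k val (x i) * val (y j) * val (z k) * val (A (i, j, k)).

Lemma imbalance_signed_sum n (A : cube n) (x y z : switches n) :
  imbalance_after A x y z = `|signed_sum A x y z|%N.
Proof. by []. Qed.

(** The signed sum is linear in each of [x], [y] and [z], so the one-directional
    second moment applies three times, each time squaring the coefficients of
    the switches already averaged out. *)
Lemma sum_signed_sum_sqr n (A : cube n) :
  \sum_z \sum_y \sum_x signed_sum A x y z ^+ 2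
  = (n ^ 3)%:Z *+ #|switches n| *+ #|switches n| *+ #|switches n|.
Proof.
pose b z i j := \sum_k val ((z : switches n) k) * val (A (i, j, k)).
pose c y z i := \sum_j val ((y : switches n) j) * b z i j.
have linear_x x y z : signed_sum A x y z = \sum_i val (x i) * c y z i.
  apply: eq_bigr => i _; rewrite big_distrr; apply: eq_bigr => j _ /=.
  by rewrite !big_distrr; apply: eq_bigr => k _ /=; ring.
have average_x y z : \sum_x signed_sum A x y z ^+ 2
    = (\sum_i c y z i ^+ 2) *+ #|switches n|.
  by under eq_bigr do rewrite linear_x; rewrite sum_switches_sqr.
have average_y z : \sum_y \sum_i c y z i ^+ 2
    = (\sum_i \sum_j b z i j ^+ 2) *+ #|switches n|.
  rewrite exchange_big -sumrMnl; apply: eq_bigr => i _.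
  exact: sum_switches_sqr.
have average_z : \sum_z \sum_i \sum_j b z i j ^+ 2
    = (n ^ 3)%:Z *+ #|switches n|.
  transitivity ((\sum_(i < n) \sum_(j < n) \sum_(k < n) 1%:Z)
                *+ #|switches n|).
    rewrite exchange_big -sumrMnl; apply: eq_bigr => i _.
    rewrite exchange_big -sumrMnl; apply: eq_bigr => j _.
    rewrite sum_switches_sqr; congr (_ *+ _).
    by apply: eq_bigr => k _; rewrite sqr_sign.
  congr (_ *+ _).
  by rewrite !sumr_const !card_ord -!mulrnA natz; congr Posz; rewrite !expnS; lia.
under eq_bigr do under eq_bigr do rewrite average_x.
under eq_bigr do rewrite sumrMnl average_y.
by rewrite !sumrMnl average_z.
Qed.

Lemma imbalance_sqr_le n (A : cube n) :
  exists x y z : switches n, (imbalance_after A x y z ^ 2 <= n ^ 3)%N.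
Proof.
have [/existsP[x /existsP[y /existsP[z le]]]|large] :=
  boolP [exists x, [exists y, [exists z, imbalance_after A x y z ^ 2 <= n ^ 3]]]%N.
  by exists x, y, z.
have {}large x y z : (n ^ 3).+1%:Z <= signed_sum A x y z ^+ 2.
  move: large; rewrite negb_exists => /forallP/(_ x).
  rewrite negb_exists => /forallP/(_ y); rewrite negb_exists => /forallP/(_ z).
  rewrite -ltnNge imbalance_signed_sum -abszX => lt_sq.
  by rewrite -[_ ^+ 2]gez0_abs ?sqr_ge0 // lez_nat.
have switches_gt0 : (0 < #|switches n|)%N.
  by apply/card_gt0P; exists [ffun=> plus].
have: (n ^ 3).+1%:Z *+ #|switches n| *+ #|switches n| *+ #|switches n|
      <= \sum_z \sum_y \sum_x signed_sum A x y z ^+ 2.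
  rewrite -!sumr_const; apply: ler_sum => z _; apply: ler_sum => y _.
  exact: ler_sum.
by rewrite sum_signed_sum_sqr !lerMn2r !eqn0Ngt switches_gt0 /= lez_nat ltnn.
Qed.

(** Appending a sign [e] to signs of product [p] changes the difference of the
    two sides by [(e - 1) * (1 - p)], a product of two even numbers. *)
Lemma sum_signs_mod4 (T : Type) (r : seq T) (f : T -> int) :
    (forall t, f t = 1 \/ f t = -1) ->
  (\sum_(t <- r) f t = (size r)%:Z + \prod_(t <- r) f t - 1 %[mod 4])%Z.
Proof.
move=> f_sign.
suff: (\prod_(t <- r) f t = 1 \/ \prod_(t <- r) f t = -1) /\
  (\sum_(t <- r) f t = (size r)%:Z + \prod_(t <- r) f t - 1 %[mod 4])%Z by case.
elim: r => [|t r [IHprod IHsum]]; first by rewrite !big_nil; split; [left|].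
rewrite !big_cons /=; move: IHsum; set S := \sum_(_ <- _) _.
by case: (f_sign t) => ->; case: IHprod => ->; split; lia.
Qed.

Lemma exprn_sign_even n s : ~~ odd n -> val s ^+ n = 1.
Proof.
by move=> even_n; rewrite -(even_halfK even_n) -mul2n exprM sqr_sign expr1n.
Qed.

(** Each switch occurs [n ^ 2] times in the product of all lights, hence cancels
    when [n] is even. *)
Lemma prod_lights_even n (A : cube n) (x y z : switches n) : ~~ odd n ->
  \prod_i \prod_j \prod_k (val (x i) * val (y j) * val (z k) * val (A (i, j, k)))
  = \prod_i \prod_j \prod_k val (A (i, j, k)).
Proof.
move=> even_n.
have cancel (a : int) s : \prod_(k < n) (a * val s) = \prod_(k < n) a.
  by rewrite big_split /= !prodr_const card_ord exprn_sign_even ?mulr1.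
have prodx s : \prod_(k < n) val s = 1.
  by rewrite prodr_const card_ord exprn_sign_even.
have prodz : \prod_(j < n) \prod_k val (z k) = 1.
  by rewrite exchange_big big1 // => k _; rewrite prodx.
apply: eq_bigr => i _; transitivity
  (\prod_(j < n) ((\prod_k val (z k)) * \prod_k val (A (i, j, k)))).
  apply: eq_bigr => j _; rewrite !big_split /=.
  by rewrite !prodx !mul1r.
by rewrite big_split /= prodz mul1r.
Qed.

Lemma pair_triple_big (R : Type) (idx : R) (op : Monoid.com_law idx)
    (I J K : finType) (F : I -> J -> K -> R) :
  \big[op/idx]_i \big[op/idx]_j \big[op/idx]_k F i j k
  = \big[op/idx]_(p : I * (J * K)) F p.1 p.2.1 p.2.2.
Proof. by under eq_bigr do rewrite pair_bigA; rewrite pair_bigA. Qed.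

Lemma signed_sum_mod4 n (A : cube n) (x y z : switches n) : ~~ odd n ->
  (signed_sum A x y z
   = (n ^ 3)%:Z + \prod_i \prod_j \prod_k val (A (i, j, k)) - 1 %[mod 4])%Z.
Proof.
move=> even_n; rewrite -(prod_lights_even A x y z even_n) /signed_sum.
rewrite !pair_triple_big sum_signs_mod4; last first.
  move=> [i [j k]] /=.
  by case: (signP (x i)) => ->; case: (signP (y j)) => ->;
     case: (signP (z k)) => ->; case: (signP (A (i, j, k))) => ->;
     [left|right|..]; auto.
by rewrite -[index_enum _]enumT -cardE !card_prod !card_ord.
Qed.

Definition one_off : cube 2 :=
  [ffun p => if p == (ord0, ord0, ord0) then opp_sign plus else plus].

Lemma imbalance_one_off_ge2 (x y z : switches 2) :
  (2 <= imbalance_after one_off x y z)%N.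
Proof.
have := signed_sum_mod4 one_off x y z isT.
rewrite !big_ord_recl !big_ord0 !ffunE /= imbalance_signed_sum.
lia.
Qed.

Lemma attainable_2_2 : attainable 2 2.
Proof.
apply/forallP=> A; have [x [y [z le8]]] := imbalance_sqr_le A.
apply/existsP; exists x; apply/existsP; exists y; apply/existsP; exists z.
nia.
Qed.

End Cube.

Theorem theorem2 : P 2 = 2.
Proof.
have [att le_P] := P_min 2; apply/eqP.
rewrite eqn_leq le_P ?attainable_2_2 //=.
have /existsP[x /existsP[y /existsP[z]]] := forallP att one_off.
exact/leq_trans/imbalance_one_off_ge2.
Qed.
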